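(* If a digraph $D$ has the tournament forcing property, then either $D$ has the tournament Sidorenko property or $D$ has the tournament anti-Sidorenko property.
   Context: All digraphs are oriented graphs (no loops, no antiparallel edges). A tournament is an orientation of a complete graph without loops. For digraphs $D,T$, $h_D(T)$ is the number of maps $\phi:V(D)\to V(T)$ with $(\phi(x),\phi(y))\in E(T)$ for all $(x,y)\in E(D)$, and $t_D(T)=h_D(T)/v(T)^{v(D)}$. $D$ has the tournament Sidorenko property if $t_D(T)\ge (1-o(1))2^{-e(D)}$ for all tournaments $T$ (with $o(1)\to0$ as $v(T)\to\infty$), and the tournament anti-Sidorenko property if $t_D(T)\le 2^{-e(D)}$ for all tournaments $T$. For $A,B\subseteq V(T)$, $e(A,B)$ is the number of pairs $(a,b)\in A\times B$ with $(a,b)\in E(T)$. A tournament $T$ on $n$ vertices has $\epsilon$-quasirandom direction if $e(A,B)-e(B,A)\le \epsilon n^2$ for all $A,B\subseteq V(T)$. A sequence of tournaments $(T_n)_{n\in\mathbb N}$, $T_n$ on $n$ vertices, has quasirandom direction if each $T_n$ has $\epsilon_n$-quasirandom direction for some sequence $\epsilon_n\to0$. A digraph $D$ has the tournament forcing property if a sequence $(T_n)$ ($T_n$ on $n$ vertices) has quasirandom direction if and only if $t_D(T_n)=2^{-e(D)}+o(1)$ as $n\to\infty$. *)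

(* Defs.v *)
From mathcomp Require Import all_boot all_order all_algebra.
From mathcomp Require Import all_classical all_reals topology.
From mathcomp Require Import normedtype sequences.

Set Implicit Arguments.
Unset Strict Implicit.
Unset Printing Implicit Defensive.

Import Order.TTheory GRing.Theory Num.Theory.
Import numFieldNormedType.Exports.

Local Open Scope classical_set_scope.
Local Open Scope ring_scope.

(* Taking y := x in [arc_asym] also rules out loops. *)
Record digraph := Digraph {
  vertex :> finType;
  arc : rel vertex;
  arc_asym : forall x y : vertex, arc x y -> ~~ arc y x }.

Record tournament := Tournament {
  tdigraph :> digraph;
  tournament_total : forall x y : tdigraph, x != y -> arc x y || arc y x }.

Definition num_arcs (D : digraph) : nat :=
  #|[set p : vertex D * vertex D | arc p.1 p.2]%SET|.

Definition is_hom (D T : digraph) (f : {ffun vertex D -> vertex T}) : bool :=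
  [forall x, forall y, arc x y ==> arc (f x) (f y)].

Definition hom_count (D T : digraph) : nat :=
  #|[set f : {ffun vertex D -> vertex T} | is_hom f]%SET|.

(* If T has no vertex, then the density is 0 / 0 = 0 (1 / 1 = 1 if D has no
   vertex either), which affects none of the properties below. *)
Definition hom_density (R : realType) (D T : digraph) : R :=
  (hom_count D T)%:R / (#|vertex T| ^ #|vertex D|)%:R.

Definition tournament_sidorenko (R : realType) (D : digraph) : Prop :=
  exists2 delta : nat -> R, delta n @[n --> \oo] --> (0 : R) &
    forall T : tournament,
      hom_density R D T >= (1 - delta #|vertex T|) * 2 ^- num_arcs D.

Definition tournament_anti_sidorenko (R : realType) (D : digraph) : Prop :=
  forall T : tournament, hom_density R D T <= 2 ^- num_arcs D.

Definition arcs_between (T : digraph) (A B : {set vertex T}) : nat :=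
  #|[set p : vertex T * vertex T | [&& p.1 \in A, p.2 \in B & arc p.1 p.2]]%SET|.

Definition eps_quasirandom_direction (R : realType) (eps : R) (T : tournament)
    : Prop :=
  forall A B : {set vertex T},
    (arcs_between A B)%:R - (arcs_between B A)%:R
      <= eps * #|vertex T|%:R ^+ 2.

Definition quasirandom_direction (R : realType) (T : nat -> tournament)
    : Prop :=
  exists2 eps : nat -> R, eps n @[n --> \oo] --> (0 : R) &
    forall n, eps_quasirandom_direction (eps n) (T n).

Definition tournament_forcing (R : realType) (D : digraph) : Prop :=
  forall T : nat -> tournament,
    (forall n, #|vertex (T n)| = n) ->
    quasirandom_direction R T <->
    hom_density R D (T n) @[n --> \oo] --> (2 ^- num_arcs D : R).

(* Main.v *)
(** If [D] is neither tournament Sidorenko nor anti-Sidorenko, then blowing up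
    one tournament of too large density, and one large enough tournament of too
    small density, gives for every large [n] tournaments [A_n] and [B_n] on
    [n] vertices whose densities are bounded away from [2^-e(D)] from above and
    from below.  Let [C_{n,k}] have its first [k] vertices as in [A_n], the
    others as in [B_n], and all arcs from the first group to the second.  The
    density of [C_{n,k}] changes by at most [v(D)/n] when [k] increases by one,
    so some [k = k(n)] makes it converge to [2^-e(D)]; and both [k(n)] and
    [n - k(n)] must then be linear in [n], so the [k(n) (n - k(n))] arcs across
    prevent quasirandom direction. *)
From Pilot Require Import Defs.
From mathcomp Require Import all_boot all_order all_algebra.
From mathcomp Require Import all_classical all_reals topology.
From mathcomp Require Import normedtype sequences.
From mathcomp Require Import ring lra.

Set Implicit Arguments.
Unset Strict Implicit.
Unset Printing Implicit Defensive.

Import Order.TTheory GRing.Theory Num.Theory.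
Import numFieldNormedType.Exports.
(* [arc] must denote the field of [digraph], not [path.arc]. *)
Import Pilot.Defs.

Local Open Scope classical_set_scope.
Local Open Scope ring_scope.

(** * Counting maps between finite sets *)

(* Each [f] in [S] gives [#|B|] maps by changing its value at [x]; by
   hypothesis these are distinct for distinct [f]. *)
Lemma card_determined_off (A B : finType) (x : A) (S : {set {ffun A -> B}}) :
  {in S &, forall f g : {ffun A -> B}, (forall y, y != x -> f y = g y) -> f = g} ->
  (#|S| * #|B| <= #|B| ^ #|A|)%N.
Proof.
move=> detS; rewrite -card_ffun -[#|B|]cardsT -cardsX.
pose upd (p : {ffun A -> B} * B) := [ffun y => if y == x then p.2 else p.1 y].
suff /card_in_imset <- : {in finset.setX S [set: B]%SET &, injective upd}.
  exact: max_card.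
move=> [f b] [g c] /finset.setXP[/= fS _] /finset.setXP[/= gS _] /ffunP eq_upd.
congr pair; last by have := eq_upd x; rewrite !ffunE eqxx.
by apply: detS => // y /negPf yx; have := eq_upd y; rewrite !ffunE yx.
Qed.

Lemma card_bigcup_le (I T : finType) (P : pred I) (F : I -> {set T}) :
  (#|\bigcup_(i | P i) F i| <= \sum_(i | P i) #|F i|)%N.
Proof.
elim/big_ind2: _ => [|a A b B leA leB|//]; first by rewrite cards0.
by rewrite (leq_trans (leq_card_setU A B)) ?leq_add.
Qed.

(** Union bound over [x]: a map with [f x = b] is determined by its values off [x]. *)
Lemma card_hitting (A B : finType) (b : B) :
  (#|[set f : {ffun A -> B} | [exists x, f x == b]]%SET| * #|B|
    <= #|A| * #|B| ^ #|A|)%N.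
Proof.
apply: (@leq_trans ((\sum_(x : A) #|[set f : {ffun A -> B} | f x == b]%SET|) * #|B|)).
  rewrite leq_mul2r (leq_trans _ (card_bigcup_le _ _)) ?orbT//.
  apply/subset_leq_card/fintype.subsetP => f; rewrite inE => /existsP[x fx].
  by apply/bigcupP; exists x; rewrite ?inE.
rewrite big_distrl /= -sum_nat_const; apply: leq_sum => x _.
apply: (@card_determined_off _ _ x) => f g; rewrite !inE => /eqP fx /eqP gx fg.
by apply/ffunP => y; have [->|/fg//] := eqVneq y x; rewrite fx gx.
Qed.

(** Union bound over pairs [x != y]: if [f x = f y], the value at [x] can be read off at [y]. *)
Lemma card_non_injective (A B : finType) :
  (#|[set f : {ffun A -> B} | ~~ injectiveb f]%SET| * #|B|
    <= #|A| ^ 2 * #|B| ^ #|A|)%N.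
Proof.
pose F (p : A * A) := [set f : {ffun A -> B} | f p.1 == f p.2]%SET.
apply: (@leq_trans ((\sum_(p : A * A | p.1 != p.2) #|F p|) * #|B|)).
  rewrite leq_mul2r (leq_trans _ (card_bigcup_le _ _)) ?orbT//.
  apply/subset_leq_card/fintype.subsetP => f; rewrite inE => /injectivePn[x [y yx fxy]].
  by apply/bigcupP; exists (x, y); rewrite ?inE ?fxy //= eq_sym.
rewrite big_distrl /= expnS expn1 -card_prod -sum_nat_const [leqRHS]big_mkcond /=.
rewrite big_mkcond; apply: leq_sum => -[x y] _ /=; case: ifP => //= xy.
apply: (@card_determined_off _ _ x) => f g; rewrite !inE /= => /eqP fx /eqP gx fg.
have fgy : f y = g y by apply: fg; rewrite eq_sym.
by apply/ffunP => z; have [->|/fg//] := eqVneq z x; rewrite fx gx.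
Qed.

(** * Pulling sets of maps back along reduction modulo [#|T|] *)

Definition cyclic_proj (T : finType) (x0 : T) (i : nat) : T :=
  nth x0 (enum T) (i %% #|T|).

(** Every residue class modulo [#|T|] has at least [n %/ #|T|] members below [n], so each value of a
    map in [Q] can be lifted independently in that many ways. *)
Lemma card_pullback (A T : finType) (x0 : T) (Q : {set {ffun A -> T}}) (n : nat) :
  (#|Q| * (n %/ #|T|) ^ #|A| <=
   #|[set f : {ffun A -> 'I_n} | [ffun x => cyclic_proj x0 (f x)] \in Q]%SET|)%N.
Proof.
case: n => [|n].
  (* For [n = 0] only an empty [A] matters: there [0 ^ 0 = 1], so a nonempty [Q] requires the empty
     map to be exhibited. *)
  rewrite div0n; have [A0|A0] := posnP #|A|; last by rewrite exp0n // muln0.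
  rewrite A0 expn0 muln1.
  have := max_card (mem Q); rewrite card_ffun A0 expn0.
  case: (set_0Vmem Q) => [->|[f fQ] Q1]; first by rewrite cards0.
  have f0 : forall x : A, False by move=> x; have := fintype.card0_eq A0 x.
  apply: leq_trans Q1 _; rewrite card_gt0; apply/set0Pn.
  exists [ffun x => False_rect _ (f0 x)]; rewrite inE.
  by rewrite (_ : finfun _ = f) //; apply/ffunP => x; case: (f0 x).
set m := #|T|; set q := (n.+1 %/ m)%N.
have m_gt0 : (0 < m)%N by apply/card_gt0P; exists x0.
have bound (j : 'I_q) (t : T) : (j * m + enum_rank t < n.+1)%N.
  apply: (@leq_trans (j.+1 * m)); first by rewrite mulSn addnC ltn_add2r ltn_ord.
  by apply: leq_trans (leq_divM n.+1 m); rewrite leq_mul2r ltn_ord orbT.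
(* [i < q * #|T|] is determined by its residue class and its quotient. *)
pose glue (p : {ffun A -> T} * {ffun A -> 'I_q}) :=
  [ffun x => inord (p.2 x * m + enum_rank (p.1 x)) : 'I_n.+1].
have glueE p x : glue p x = (p.2 x * m + enum_rank (p.1 x))%N :> nat.
  by rewrite ffunE inordK.
have glue_mod p x : (glue p x %% m)%N = enum_rank (p.1 x).
  by rewrite glueE modnMDl modn_small // ltn_ord.
have glue_div p x : (glue p x %/ m)%N = p.2 x.
  by rewrite glueE divnMDl // divn_small ?ltn_ord // addn0.
have glue_inj : injective glue.
  move=> [f j] [g k] E; congr pair; apply/ffunP => x.
    by apply/enum_rank_inj/val_inj; rewrite /= -(glue_mod (f, j)) E glue_mod.
  by apply/val_inj; rewrite /= -(glue_div (f, j)) E glue_div.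
rewrite -{1}(card_ord q) -card_ffun -[X in (_ * X)%N]cardsT -cardsX -(card_imset _ glue_inj).
apply/subset_leq_card/fintype.subsetP => _ /imsetP[[f j] /finset.setXP[/= fQ _] ->].
rewrite inE (_ : finfun _ = f) //; apply/ffunP => x.
by rewrite ffunE /cyclic_proj glue_mod nth_enum_rank.
Qed.

Section Density.
Variable R : realType.

(** Bernoulli's inequality for [x = 1 - (1 - x)]. *)
Lemma one_sub_exp_le (x : R) (d : nat) :
  0 <= x -> x <= 1 -> 1 - d%:R * (1 - x) <= x ^+ d.
Proof.
move=> x0 x1; elim: d => [|d IH]; first by rewrite expr0 mul0r subr0.
rewrite exprS -natr1; have := ler_wpM2l x0 IH.
have : 0 <= d%:R * (1 - x) ^+ 2 :> R by rewrite mulr_ge0 ?sqr_ge0.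
nra.
Qed.

Lemma pullback_density (A T : finType) (x0 : T) (Q : {set {ffun A -> T}}) (n : nat) :
  (0 < n)%N ->
  #|Q|%:R / (#|T| ^ #|A|)%:R - (#|A| * #|T|)%:R / n%:R <=
   #|[set f : {ffun A -> 'I_n} | [ffun x => cyclic_proj x0 (f x)] \in Q]%SET|%:R
     / (n ^ #|A|)%:R :> R.
Proof.
move=> n0; set m := #|T|; set d := #|A|; set q := (n %/ m)%N.
have m0 : (0 < m)%N by apply/card_gt0P; exists x0.
have nR0 : 0 < n%:R :> R by rewrite ltr0n.
have mR0 : 0 < m%:R :> R by rewrite ltr0n.
have := card_pullback x0 Q n; rewrite -(ler_nat R).
rewrite -(ler_pM2r (_ : 0 < (n ^ d)%:R^-1)); last by rewrite invr_gt0 ltr0n expn_gt0 n0.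
apply: le_trans.
set s : R := #|Q|%:R / (m ^ d)%:R.
have s0 : 0 <= s by rewrite divr_ge0.
have s1 : s <= 1.
  by rewrite ler_pdivrMr ?ltr0n ?expn_gt0 ?m0 // mul1r ler_nat -card_ffun max_card.
(* The fraction of ['I_n] covered by complete blocks of length [m]; less than one block is lost. *)
pose x : R := q%:R * m%:R / n%:R.
have -> : (#|Q| * q ^ d)%:R / (n ^ d)%:R = s * x ^+ d.
  rewrite /s /x !exprMn exprVn !natrM !natrX.
  by field; rewrite !expf_neq0 // gt_eqF.
have x0' : 0 <= x by rewrite /x divr_ge0 ?mulr_ge0.
have x1 : x <= 1 by rewrite /x ler_pdivrMr // mul1r -natrM ler_nat leq_divM.
have xy : 1 - m%:R / n%:R <= x.
  rewrite /x -[X in X - _](divff (lt0r_neq0 nR0)) -mulrBl ler_pM2r ?invr_gt0 //.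
  rewrite lerBlDr -natrM -natrD ler_nat {1}(divn_eq n m) leq_add2l.
  by rewrite ltnW // ltn_mod.
have := one_sub_exp_le d x0' x1.
have y0 : 0 <= m%:R / n%:R :> R by rewrite divr_ge0.
rewrite natrM -mulrA; set y := m%:R / n%:R in xy y0 *.
have dy : d%:R * (1 - x) <= d%:R * y by rewrite ler_wpM2l //; lra.
have dy0 : 0 <= d%:R * y by rewrite mulr_ge0.
(* Since [s <= 1], [s * x ^+ d >= s * (1 - d * y) >= s - d * y]. *)
nra.
Qed.

(** * Densities in the restrictions of a relation to initial segments *)

Definition rel_homs (D : digraph) (r : rel nat) (n : nat) :
    {set {ffun vertex D -> 'I_n}} :=
  [set f : {ffun vertex D -> 'I_n} |
    [forall x, forall y, arc x y ==> r (f x) (f y)]]%SET.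

(** One relation on [nat] encodes a tournament of every order, so [n] and the cut point [k] can vary
    without changing vertex types. *)
Definition rel_density (D : digraph) (r : rel nat) (n : nat) : R :=
  #|rel_homs D r n|%:R / (n ^ #|vertex D|)%:R.

Definition asymmetric (r : rel nat) := forall i j, r i j -> ~~ r j i.
Definition semiconnex (r : rel nat) := forall i j, i != j -> r i j || r j i.

Definition ord_digraph (r : rel nat) (r_asym : asymmetric r) (n : nat) : digraph :=
  @Digraph 'I_n (fun i j => r i j) (fun i j => r_asym i j).

Definition ord_tournament (r : rel nat) (r_asym : asymmetric r)
    (r_total : semiconnex r) (n : nat) : tournament :=
  @Tournament (ord_digraph r_asym n) (fun i j => r_total i j).

Lemma hom_density_ord (D : digraph) (r : rel nat) (r_asym : asymmetric r)
    (r_total : semiconnex r) (n : nat) :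
  hom_density R D (ord_tournament r_asym r_total n) = rel_density D r n.
Proof. by rewrite /hom_density /= card_ord. Qed.

Lemma eq_rel_density (D : digraph) (r r' : rel nat) (n : nat) :
  (forall i j, (i < n)%N -> (j < n)%N -> r i j = r' i j) ->
  rel_density D r n = rel_density D r' n.
Proof.
move=> rr'; congr (_%:R / _); apply: eq_card => f; rewrite !inE.
by apply: eq_forallb => x; apply: eq_forallb => y; rewrite rr'.
Qed.

(** * Joining two tournaments *)

Definition join_rel (r s : rel nat) (k : nat) : rel nat := fun i j =>
  if (i < k)%N then (if (j < k)%N then r i j else true)
  else (if (j < k)%N then false else s i j).

Lemma join_rel_asym (r s : rel nat) (k : nat) :
  asymmetric r -> asymmetric s -> asymmetric (join_rel r s k).
Proof. by move=> ra sa i j; rewrite /join_rel; do 2!case: ifP => //; auto. Qed.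

Lemma join_rel_total (r s : rel nat) (k : nat) :
  semiconnex r -> semiconnex s -> semiconnex (join_rel r s k).
Proof. by move=> rt st i j ij; rewrite /join_rel; do 2!case: ifP => //; auto. Qed.

(* Only the maps hitting [k] can be homomorphisms for [r] but not for [s]. *)
Lemma rel_density_le_step (D : digraph) (r s : rel nat) (n k : nat) :
  (k < n)%N ->
  (forall i j, i != k -> j != k -> r i j = s i j) ->
  rel_density D r n <= rel_density D s n + #|vertex D|%:R / n%:R.
Proof.
move=> kn rs; set d := #|vertex D|.
have n0 : (0 < n)%N by apply: leq_ltn_trans kn.
have nd0 : 0 < (n ^ d)%:R :> R by rewrite ltr0n expn_gt0 n0.
pose H := [set f : {ffun vertex D -> 'I_n} | [exists x, f x == Ordinal kn]]%SET.
have sub : rel_homs D r n \subset rel_homs D s n :|: H.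
  apply/fintype.subsetP => f; rewrite !inE => /forallP homf.
  case: (boolP [exists x, _]) => [|/existsPn noHit]; first by rewrite orbT.
  rewrite orbF; apply/forallP => x; apply/forallP => y.
  by have /forallP/(_ y) := homf x; rewrite rs //; apply: noHit.
have := leq_trans (subset_leq_card sub) (leq_card_setU _ _).
rewrite -(ler_nat R) natrD -(ler_pM2r (_ : 0 < (n ^ d)%:R^-1)) ?invr_gt0 //.
move/le_trans; apply; rewrite mulrDl lerD2l ler_pdivrMr // mulrAC.
rewrite ler_pdivlMr ?ltr0n // -!natrM ler_nat.
by have := @card_hitting (vertex D) _ (Ordinal kn); rewrite card_ord.
Qed.

(** The two joins differ only in arcs at the vertex [k]. *)
Lemma join_rel_density_step (D : digraph) (r s : rel nat) (n k : nat) :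
  (k < n)%N ->
  `|rel_density D (join_rel r s k.+1) n - rel_density D (join_rel r s k) n|
    <= #|vertex D|%:R / n%:R.
Proof.
move=> kn.
have E i j : i != k -> j != k -> join_rel r s k.+1 i j = join_rel r s k i j.
  by rewrite /join_rel => ik jk; rewrite !ltnS (leq_eqVlt i) (leq_eqVlt j) (negPf ik) (negPf jk).
have E' i j : i != k -> j != k -> join_rel r s k i j = join_rel r s k.+1 i j.
  by move=> ik jk; rewrite E.
have := rel_density_le_step D kn E; have := rel_density_le_step D kn E'.
by move=> le1 le2; rewrite ler_norml; apply/andP; split; lra.
Qed.

Lemma join_rel_density_dist (D : digraph) (r s : rel nat) (n k l : nat) :
  (k + l <= n)%N ->
  rel_density D (join_rel r s (k + l)) n
    <= rel_density D (join_rel r s k) n + #|vertex D|%:R * l%:R / n%:R.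
Proof.
elim: l => [|l IH]; first by rewrite addn0 mulr0 mul0r addr0.
rewrite addnS => kln; have /ler_normlW := join_rel_density_step D r s kln.
have := IH (ltnW kln); rewrite -natr1 mulrDr mulr1 mulrDl; lra.
Qed.

(** A discrete intermediate value argument: the least [k] with density at least [c] overshoots by at
    most one step. The density moves by about [eps] on either side of this [k], in steps of at most
    [#|vertex D| / n], which gives the linear bounds; the overshoot costs the term
    [- #|vertex D|]. *)
Lemma join_rel_balance (D : digraph) (r s : rel nat) (c eps : R) (n : nat) :
  (0 < n)%N -> 0 < eps ->
  c + eps <= rel_density D r n -> rel_density D s n <= c - eps ->
  exists k, [/\ (k <= n)%N,
    c <= rel_density D (join_rel r s k) n <= c + #|vertex D|%:R / n%:R,
    eps * n%:R <= #|vertex D|%:R * k%:R &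
    eps * n%:R - #|vertex D|%:R <= #|vertex D|%:R * (n - k)%:R].
Proof.
move=> n0 eps0; set d := #|vertex D|; set g := fun k => rel_density D (join_rel r s k) n.
have nR0 : 0 < n%:R :> R by rewrite ltr0n.
(* Below [n], the join is [r] for cut point [n] and [s] for cut point [0]. *)
rewrite -(@eq_rel_density D (join_rel r s n)); last by rewrite /join_rel => i j -> ->.
rewrite -(@eq_rel_density D (join_rel r s 0) s) // -!/(g _) => gn g0.
have exk : exists k, (k <= n)%N && (c <= g k) by exists n; rewrite leqnn; lra.
case: (ex_minnP exk) => k /andP[kn gk] kmin; exists k.
have upper : g k <= c + d%:R / n%:R.
  case: k kn gk kmin => [|k] kn gk kmin; first by lra.
  have gk' : g k < c.
    rewrite ltNge; apply/negP => ck.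
    by have := kmin k; rewrite ltnn (ltnW kn) ck => /(_ isT).
  have /ler_normlW := join_rel_density_step D r s kn.
  by rewrite -!/(g _) -/d; lra.
split=> //; first by rewrite -/(g k) gk.
- have := @join_rel_density_dist D r s n 0 k kn.
  rewrite add0n -!/(g _) => dist; rewrite -ler_pdivlMr //; lra.
have := @join_rel_density_dist D r s n k (n - k).
rewrite subnKC // -!/(g _) => /(_ (leqnn n)) dist.
rewrite lerBlDr -{2}(mulr1 d%:R) -mulrDr -ler_pdivlMr // mulrDr mulr1 mulrDl.
by rewrite -/d in dist; lra.
Qed.

Lemma join_rel_arcs (r s : rel nat) (k n : nat)
    (J_asym : asymmetric (join_rel r s k)) (T := ord_digraph J_asym n)
    (A := [set i : 'I_n | (i < k)%N]%SET : {set vertex T}) :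
  (k <= n)%N ->
  arcs_between A (~: A)%SET = (k * (n - k))%N /\ arcs_between (~: A)%SET A = 0%N.
Proof.
move=> kn; have cardA : #|A| = k.
  rewrite cardsE -sum1_card (eq_bigl (fun i : 'I_n => (i < k)%N)) //.
  by rewrite (big_ord_narrow kn) sum1_card card_ord.
split; last first.
  apply/eqP; rewrite cards_eq0; apply/eqP/setP => -[i j]; rewrite !inE /=.
  by rewrite /join_rel; case: ifP => //= _; case: ifP.
have <- : #|(~: A)%SET| = (n - k)%N by rewrite cardsCs finset.setCK cardA card_ord.
rewrite -{1}cardA -cardsX; apply: eq_card => -[i j]; rewrite !inE /=.
by rewrite /join_rel; case: ifP => //= _; case: ifP.
Qed.

(** * Refuting the forcing property *)

Lemma cvg_divn (x : R) : x / n%:R @[n --> \oo] --> (0 : R).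
Proof.
rewrite -(cvg_shiftS (fun n : nat => x / n%:R)).
have lim : x * harmonic n @[n --> \oo] --> (x * 0 : R).
  by apply: cvgM; [exact: cvg_cst | exact: cvg_harmonic].
by rewrite mulr0 in lim; exact: lim.
Qed.

Lemma not_forcing (D : digraph) (r s : rel nat) (eps : R) (N : nat) :
  asymmetric r -> semiconnex r -> asymmetric s -> semiconnex s -> 0 < eps ->
  (forall n, (N <= n)%N -> 2 ^- num_arcs D + eps <= rel_density D r n) ->
  (forall n, (N <= n)%N -> rel_density D s n <= 2 ^- num_arcs D - eps) ->
  ~ tournament_forcing R D.
Proof.
move=> ra rt sa st eps0; set c := 2 ^- _; set d := #|vertex D| => r_ge s_le forcing.
have /choice[k kP] : forall n, exists k, (maxn N 1 <= n)%N -> [/\ (k <= n)%N,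
    c <= rel_density D (join_rel r s k) n <= c + d%:R / n%:R,
    eps * n%:R <= d%:R * k%:R & eps * n%:R - d%:R <= d%:R * (n - k)%:R].
  move=> n; case: (leqP (maxn N 1) n) => [|_]; last by exists 0%N.
  rewrite geq_max => /andP[Nn n0].
  by have [k ?] := join_rel_balance n0 eps0 (r_ge n Nn) (s_le n Nn); exists k.
pose Ja n := @join_rel_asym r s (k n) ra sa; pose Jt n := @join_rel_total r s (k n) rt st.
have [_] := forcing (fun n => ord_tournament (Ja n) (Jt n) n) (fun n => card_ord n).
case.
  apply: (@squeeze_cvgr _ _ _ _ (fun=> c) (fun n => c + d%:R / n%:R)).
  - near=> n; rewrite hom_density_ord.
    by have [] := kP n; first by near: n; exists (maxn N 1).
  - exact: cvg_cst.
  - rewrite -[X in _ --> X](addr0 c); exact: cvgD (cvg_cst c) (cvg_divn _).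
move=> e e0 Tqr.
(* The cut has at least [eps * n * (eps * n - d) / d ^ 2] arcs, hence at least
   [eps ^ 2 / 2 * n ^ 2 / d ^ 2] once [d / n < eps / 2]. The extra [1] keeps the threshold for [e n]
   defined when [d = 0]. *)
have d2 : 0 < d%:R ^+ 2 + 1 :> R by rewrite ltr_wpDl ?sqr_ge0.
have e1 : 0 < eps ^+ 2 / 2 / (d%:R ^+ 2 + 1) by rewrite !divr_gt0 ?exprn_gt0.
have := (cvgrPdist_lt _ _).1 e0 _ e1.
have := (cvgrPdist_lt _ _).1 (cvg_divn d%:R) _ (divr_gt0 eps0 (ltr0n _ 2)).
move=> small_d small_e; near \oo => n.
have nN : (maxn N 1 <= n)%N by near: n; exists (maxn N 1).
have n0 : 0 < n%:R :> R by rewrite ltr0n; move: nN; rewrite geq_max => /andP[].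
have [kn _ k_ge nk_ge] := kP n nN.
have : `|0 - d%:R / n%:R| < eps / 2 by near: n; exact: small_d.
rewrite sub0r normrN ger0_norm ?divr_ge0 // ltr_pdivrMr // => dn.
have : `|0 - e n| < eps ^+ 2 / 2 / (d%:R ^+ 2 + 1) by near: n; exact: small_e.
rewrite sub0r normrN => /(le_lt_trans (ler_norm _)); rewrite ltr_pdivlMr // => en.
have [AB BA] := join_rel_arcs (Ja n) kn.
have := Tqr n [set i : 'I_n | (i < k n)%N]%SET (~: [set i : 'I_n | (i < k n)%N])%SET.
rewrite AB BA subr0 card_ord natrM => qr.
have P1 : eps * n%:R * (eps * n%:R - d%:R) <= d%:R * (k n)%:R * (d%:R * (n - k n)%:R).
  have h : 0 <= eps * n%:R by rewrite mulr_ge0 ?ltW.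
  by apply: ler_pM => //; nra.
have P2 : d%:R ^+ 2 * ((k n)%:R * (n - k n)%:R) <= d%:R ^+ 2 * (e n * n%:R ^+ 2).
  by rewrite ler_wpM2l ?sqr_ge0.
have P3 : eps * n%:R * (eps * n%:R / 2) <= eps * n%:R * (eps * n%:R - d%:R).
  by rewrite ler_wpM2l ?mulr_ge0 ?ltW //; nra.
(* The sign gives [e n * d ^ 2 <= e n * (d ^ 2 + 1)], which contradicts the choice of threshold. *)
have en0 : 0 <= e n.
  have := le_trans (mulr_ge0 (ler0n R (k n)) (ler0n R (n - k n))) qr.
  by rewrite pmulr_lge0 // exprn_gt0.
have P4 : eps ^+ 2 / 2 * n%:R ^+ 2 <= e n * d%:R ^+ 2 * n%:R ^+ 2 by nra.
have : eps ^+ 2 / 2 <= e n * d%:R ^+ 2 by rewrite -(ler_pM2r (exprn_gt0 2 n0)).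
nra.
Unshelve. all: by end_near. Qed.

(** * Blow-ups of a tournament *)

(* Blow-up of [T] on the natural numbers; each class is ordered transitively. *)
Definition blowup_rel (T : tournament) (x0 : vertex T) : rel nat := fun i j =>
  arc (cyclic_proj x0 i) (cyclic_proj x0 j)
  || (cyclic_proj x0 i == cyclic_proj x0 j) && (i < j)%N.

Lemma arc_irrefl (D : digraph) (x : vertex D) : arc x x = false.
Proof. by apply/negP => xx; have := arc_asym xx; rewrite xx. Qed.

Lemma blowup_rel_asym (T : tournament) (x0 : vertex T) : asymmetric (blowup_rel x0).
Proof.
move=> i j; rewrite /blowup_rel; case/orP => [ij|/andP[/eqP-> ij]].
  rewrite (negPf (arc_asym ij)) /=; case: eqVneq ij => // ->.
  by rewrite arc_irrefl.
by rewrite arc_irrefl eqxx /= -leqNgt ltnW.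
Qed.

Lemma blowup_rel_total (T : tournament) (x0 : vertex T) : semiconnex (blowup_rel x0).
Proof.
move=> i j ij; rewrite /blowup_rel [cyclic_proj x0 j == _]eq_sym.
case: eqVneq => [->|/tournament_total]; first by rewrite arc_irrefl -neq_ltn.
by rewrite !orbF.
Qed.

(** Arcs of [T] lift to all pairs between the classes, so any lift of a homomorphism to [T] is a
    homomorphism. *)
Lemma blowup_density_ge (D : digraph) (T : tournament) (x0 : vertex T) (n : nat) :
  (0 < n)%N ->
  hom_density R D T - (#|vertex D| * #|vertex T|)%:R / n%:R
    <= rel_density D (blowup_rel x0) n.
Proof.
move=> n0; apply: le_trans (pullback_density x0 _ n0) _.
rewrite ler_pM2r ?invr_gt0 ?ltr0n ?expn_gt0 ?n0 // ler_nat.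
apply/subset_leq_card/fintype.subsetP => f; rewrite !inE => /forallP homf.
apply/forallP => x; apply/forallP => y; have /forallP/(_ y) := homf x.
by rewrite !ffunE /blowup_rel; case: arc => //= ->.
Qed.

(* A homomorphism to the blow-up projects to a homomorphism to [T] unless it
   sends two vertices of [D] to the same class: this gives the second term. *)
Lemma blowup_density_le (D : digraph) (T : tournament) (x0 : vertex T) (n : nat) :
  (0 < n)%N ->
  rel_density D (blowup_rel x0) n <= hom_density R D T
    + (#|vertex D| ^ 2)%:R / #|vertex T|%:R + (#|vertex D| * #|vertex T|)%:R / n%:R.
Proof.
move=> n0; set d := #|vertex D|; set m := #|vertex T|.
have m0 : (0 < m)%N by apply/card_gt0P; exists x0.
have nd0 : 0 < (n ^ d)%:R :> R by rewrite ltr0n expn_gt0 n0.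
have md0 : 0 < (m ^ d)%:R :> R by rewrite ltr0n expn_gt0 m0.
pose Hom := [set f : {ffun vertex D -> vertex T} | is_hom f]%SET.
pose NI := [set f : {ffun vertex D -> vertex T} | ~~ injectiveb f]%SET.
have cardNI : #|NI|%:R / (m ^ d)%:R <= (d ^ 2)%:R / m%:R :> R.
  rewrite ler_pdivrMr // mulrAC ler_pdivlMr ?ltr0n // -!natrM ler_nat.
  exact: card_non_injective.
have cardQ : (m ^ d <= #|(~: (Hom :|: NI))%SET| + (#|Hom| + #|NI|))%N.
  rewrite -[(m ^ d)%N]card_ffun -(cardsC (Hom :|: NI)) addnC leq_add2l.
  exact: leq_card_setU.
(* Pulling back only gives lower bounds, so it is applied to the injective non-homomorphisms: none
   of their lifts is a homomorphism to the blow-up. *)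
have cardP : (#|rel_homs D (blowup_rel x0) n|
    + #|[set f : {ffun vertex D -> 'I_n} |
          [ffun x => cyclic_proj x0 (f x)] \in (~: (Hom :|: NI))%SET]%SET| <= n ^ d)%N.
  have <- : #|{ffun vertex D -> 'I_n}| = (n ^ d)%N by rewrite card_ffun card_ord.
  rewrite -(cardsC (rel_homs D (blowup_rel x0) n)) leq_add2l.
  apply/subset_leq_card/fintype.subsetP => f; rewrite !inE negb_or negbK.
  case/andP => /negP nonhom /injectiveP inj; apply/negP => /forallP homf; apply: nonhom.
  apply/forallP => x; apply/forallP => y; apply/implyP => xy.
  have /forallP/(_ y) := homf x; rewrite xy /= /blowup_rel !ffunE.
  case/orP => // /andP[/eqP pxy _].
  have xy' : x = y by apply: inj; rewrite !ffunE.
  by move: xy; rewrite xy' arc_irrefl.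
have := pullback_density x0 (~: (Hom :|: NI))%SET n0; rewrite -/d -/m.
move: cardQ; rewrite -(ler_nat R) !natrD -(ler_pM2r (_ : 0 < (m ^ d)%:R^-1)) ?invr_gt0 //.
move: cardP; rewrite -(ler_nat R) !natrD -(ler_pM2r (_ : 0 < (n ^ d)%:R^-1)) ?invr_gt0 //.
rewrite !mulrDl !divff ?lt0r_neq0 // /rel_density /hom_density /hom_count -/d -/m -/Hom.
lra.
Qed.

(** * From an epsilon-threshold form to a single error sequence *)

Lemma hom_density_le1 (D : digraph) (T : tournament) : hom_density R D T <= 1.
Proof.
rewrite /hom_density -card_ffun; have [->|c0] := posnP #|{ffun vertex D -> vertex T}|.
  by rewrite invr0 mulr0.
by rewrite ler_pdivrMr ?ltr0n // mul1r ler_nat max_card.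
Qed.

Lemma hom_density_ge0 (D : digraph) (T : tournament) : 0 <= hom_density R D T.
Proof. by rewrite /hom_density divr_ge0. Qed.

Lemma sidorenkoP (D : digraph) :
  (forall eps : R, 0 < eps -> exists N, forall T : tournament,
     (N <= #|vertex T|)%N -> (1 - eps) * 2 ^- num_arcs D <= hom_density R D T) ->
  tournament_sidorenko R D.
Proof.
move=> sid; set c : R := 2 ^- num_arcs D.
have c0 : 0 < c by rewrite invr_gt0 exprn_gt0.
(* The error at [n] is the supremum of the relative deficits over tournaments of order [n]; adding
   [0] makes the set nonempty and its supremum nonnegative. *)
pose E n := [set x : R | x = 0 \/ exists2 T : tournament, #|vertex T| = n &
  x = 1 - hom_density R D T / c].
have E0 n : E n !=set0 by exists 0; left.
have Eub n : has_ubound (E n).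
  exists 1 => _ [->//|[T _ ->]]; have := divr_ge0 (hom_density_ge0 D T) (ltW c0); lra.
exists (fun n => sup (E n)); last first.
  move=> T; rewrite -ler_pdivlMr // lerBlDr -lerBlDl.
  by apply: ub_le_sup => //; right; exists T.
apply/cvgrPdist_le => eps eps0; have [N sidN] := sid eps eps0.
near=> n; have Nn : (N <= n)%N by near: n; exists N.
rewrite sub0r normrN ger0_norm; last by apply: ub_le_sup => //; left.
apply: ge_sup => // _ [->|[T Tn ->]]; first exact: ltW.
have := sidN T; rewrite Tn -/c => /(_ Nn); rewrite -ler_pdivlMr //; lra.
Unshelve. all: by end_near. Qed.

End Density.

Theorem theorem1p16 (R : realType) (D : digraph) :
  tournament_forcing R D ->
  tournament_sidorenko R D \/ tournament_anti_sidorenko R D.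
Proof.
move=> forcing; apply: contrapT => /not_orP[nsid nanti].
set d := #|vertex D|; set c : R := 2 ^- num_arcs D.
have [T T_gt] : exists T : tournament, c < hom_density R D T.
  apply: contrapT => /forallNP noT; apply: nanti => T.
  by rewrite leNgt; apply/negP; apply: noT.
(* Arbitrarily large [U] are needed because the upper bound for a blow-up of [U] has the error
   [d ^ 2 / #|vertex U|], which does not vanish as [n] grows. *)
have [eps eps0 largeU] : exists2 eps : R, 0 < eps & forall N, exists2 U : tournament,
    (N <= #|vertex U|)%N & hom_density R D U < (1 - eps) * c.
  apply: contrapT => noeps; apply: nsid; apply: sidorenkoP => eps eps0.
  apply: contrapT => /forallNP noN; apply: noeps; exists eps => // N.
  apply: contrapT => noU; apply: (noN N) => U NU.
  by rewrite leNgt; apply/negP => ?; apply: noU; exists U.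
have c0 : 0 < c by rewrite invr_gt0 exprn_gt0.
(* A third of the smaller gap: in the blow-up of [U] two errors of size [h] must still leave a gap
   of [h]. *)
pose h := Num.min (hom_density R D T - c) (eps * c) / 3.
have h0 : 0 < h by rewrite divr_gt0 // lt_min subr_gt0 T_gt mulr_gt0.
have h3 : h * 3 = Num.min (hom_density R D T - c) (eps * c) by rewrite divfK ?pnatr_eq0.
have hT : h * 3 <= hom_density R D T - c by rewrite h3 ge_min lexx.
have hU : h * 3 <= eps * c by rewrite h3 ge_min lexx orbT.
have bound (x : R) : exists N, forall n, (N <= n)%N -> (0 < n)%N /\ x / n%:R <= h.
  have [N _ NP] := (cvgrPdist_le _ _).1 (@cvg_divn R x) _ h0.
  exists (maxn N 1) => n; rewrite geq_max => /andP[Nn n0]; split=> //.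
  by have := NP n Nn; rewrite /= sub0r normrN; apply: le_trans (ler_norm _).
have [M MP] := bound (d ^ 2)%:R.
have [U MU U_lt] := largeU M; have {MU}[U0 dU] := MP _ MU.
have [y0 _] := card_gt0P U0.
(* An empty [T] would have density [0] if [D] has a vertex, and otherwise at most [1 = c]; neither
   exceeds [c]. *)
have [x0 _] : exists x0 : vertex T, x0 \in predT.
  apply/card_gt0P; rewrite lt0n; apply/negP => /eqP T0.
  move: T_gt; rewrite ltNge => /negP; apply; rewrite /c.
  have [D0|D0] := posnP #|vertex D|; last first.
    by rewrite /hom_density T0 exp0n // invr0 mulr0 ltW.
  suff -> : num_arcs D = 0%N by rewrite expr0 invr1 hom_density_le1.
  by apply/eqP; rewrite -leqn0 (leq_trans (max_card _)) // card_prod D0.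
have [N1 N1P] := bound (d * #|vertex T|)%:R.
have [N2 N2P] := bound (d * #|vertex U|)%:R.
apply: (@not_forcing R D (blowup_rel x0) (blowup_rel y0) h (maxn N1 N2)) => //.
- exact: blowup_rel_asym.
- exact: blowup_rel_total.
- exact: blowup_rel_asym.
- exact: blowup_rel_total.
- move=> n; rewrite geq_max => /andP[Nn _]; have [n0 small] := N1P n Nn.
  have := blowup_density_ge R D x0 n0; rewrite -/d -/c.
  by move: small hT; lra.
move=> n; rewrite geq_max => /andP[_ Nn]; have [n0 small] := N2P n Nn.
have := blowup_density_le R D y0 n0; rewrite -/d -/c.
move: dU small U_lt hU; lra.
Qed.
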